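(* Let $r\ge 1$, let $A$ be a real $r\times r$ matrix and let $R,S$ be real symmetric positive semi-definite $r\times r$ matrices such that $(A,R^{1/2})$ is controllable and $(A,S^{1/2})$ is observable. Then for every integer $n\geq r$ and every $P\in\mathcal{S}^0_r$ the matrix $\mathcal{L}_n(P):=I+(P-P_\infty)G_n$ is invertible. In addition, for every integer $n\ge r$ and every $P\in\mathcal{S}^0_r$, $$\mathcal{E}_n(P)=E^n\,\mathcal{L}_n(P)^{-1},$$ and $$\iota:=\sup_{P\in\mathcal{S}^0_r}\ \sup_{n\geq r}\ \Vert\mathcal{L}_n(P)^{-1}\Vert<\infty .$$
   Context: All matrices are real $r\times r$; $M'$ denotes the transpose of $M$; $\|\cdot\|$ is the spectral norm. $\mathcal{S}^0_r$ is the set of symmetric positive semi-definite matrices. $R^{1/2}$, $S^{1/2}$ are symmetric square roots of $R,S$. Controllability of $(A,R^{1/2})$ means that $[R^{1/2},AR^{1/2},\ldots,A^{r-1}R^{1/2}]$ has rank $r$; observability of $(A,S^{1/2})$ means that the matrix obtained by stacking $S^{1/2},S^{1/2}A,\ldots,S^{1/2}A^{r-1}$ vertically has rank $r$. For $P,Q\in\mathcal{S}^0_r$ the matrix $I+PQ$ is invertible. The Riccati map $\Phi:\mathcal{S}^0_r\to\mathcal{S}^0_r$ is $\Phi(P):=A(I+PS)^{-1}PA'+R$. It is a well-known fact that, when $(A,R^{1/2})$ is controllable and $(A,S^{1/2})$ is observable, $\Phi$ has a unique positive definite fixed point $P_\infty=\Phi(P_\infty)$, and that $E:=A(I+P_\infty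 S)^{-1}$ has spectral radius strictly less than $1$. For $P\in\mathcal{S}^0_r$: $\mathcal{E}(P):=A(I+PS)^{-1}$, and $\mathcal{E}_n(P)$ is defined by $\mathcal{E}_0(P)=I$, $\mathcal{E}_{n+1}(P)=\mathcal{E}_n(\Phi(P))\,\mathcal{E}(P)$. Set $F:=S(I+P_\infty S)^{-1}$. The Gramians $G_n$ are defined by $G_0=0$, $G_n=E'G_{n-1}E+F$ for $n\ge 1$, i.e. $G_n=\sum_{0\le k<n}(E')^kFE^k$. *)

(* Defs.v *)
From mathcomp Require Import all_boot all_order all_algebra.
From mathcomp Require Import all_classical all_reals ereal.

Set Implicit Arguments.
Unset Strict Implicit.
Unset Printing Implicit Defensive.

Import Order.TTheory GRing.Theory Num.Theory.

Local Open Scope classical_set_scope.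
Local Open Scope ring_scope.

Section Defs.
Context {K : realType} {r : nat}.
Implicit Types (A B C M N P R S : 'M[K]_r) (x : 'cV[K]_r).

Definition psdmx M : Prop :=
  M^T = M /\ forall x, 0 <= (x^T *m M *m x) 0 0.

Definition pdmx M : Prop :=
  M^T = M /\ forall x, x != 0 -> 0 < (x^T *m M *m x) 0 0.

(* A symmetric square root need not be positive semi-definite. *)
Definition sym_sqrtmx M N : Prop := N^T = N /\ N *m N = M.

Definition controllable A B : Prop :=
  \rank (\mxrow_(k < r) (A ^+ k *m B)) = r.

Definition observable A C : Prop :=
  \rank (\mxcol_(k < r) (C *m A ^+ k)) = r.

(* The norm that the library puts on matrices is the max norm. *)
Definition enorm x : K := Num.sqrt (\sum_i x i 0 ^+ 2).

(* Operator norm induced by the Euclidean norm. *)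
Definition specnorm M : K :=
  sup [set enorm (M *m x) | x in [set x | enorm x <= 1]].

(* [invmx M = M] for singular M, but [1%:M + P *m S] is invertible whenever P
   and S are positive semi-definite. *)
Definition riccati A R S P : 'M[K]_r :=
  A *m invmx (1%:M + P *m S) *m P *m A^T + R.

Definition trans A S P : 'M[K]_r := A *m invmx (1%:M + P *m S).

Fixpoint transn A R S (n : nat) P : 'M[K]_r :=
  if n is m.+1 then transn A R S m (riccati A R S P) *m trans A S P
  else 1%:M.

(* The sum over k < n of (E')^k F E^k, where E := A (I + Pinf S)^-1 and
   F := S (I + Pinf S)^-1. *)
Fixpoint gramian A S Pinf (n : nat) : 'M[K]_r :=
  if n is m.+1 then
    (trans A S Pinf)^T *m gramian A S Pinf m *m trans A S Pinf
    + S *m invmx (1%:M + Pinf *m S)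
  else 0.

Definition Lmx A S Pinf (n : nat) P : 'M[K]_r :=
  1%:M + (P - Pinf) *m gramian A S Pinf n.

End Defs.

(* Main.v *)
(* From E(P) L_(n+1)(P) = L_n(Phi(P)) E one gets E_n(P) L_n(P) = E^n, so all
   rests on a lower bound |L_n(P) x|^2 >= k |x|^2 uniform in P and n >= r.
   Write V = Pinf^-1 and W = Pinf + Pinf S Pinf, so that V - F = W^-1 and
   Pinf = E W E' + R. Then U = V - F - E' V E is positive semi-definite and
   V - G_n = sum_(k < n) (E')^k U E^k + (E')^n V E^n. Controllability makes the
   first r terms of that sum positive definite, whence G_n <= (1 - e) V with
   e > 0 independent of n; observability makes G_r, hence every G_n with
   n >= r, bounded below. Pairing L_n(P) x with G_n x and discarding P >= 0
   gives the bound. *)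
Require Import Defs.
From mathcomp Require Import all_boot all_order all_algebra.
From mathcomp Require Import all_classical all_reals ereal.
From mathcomp Require Import lra.

Import Order.TTheory GRing.Theory Num.Theory.
Local Open Scope classical_set_scope.
Local Open Scope ring_scope.

(** * Euclidean inner product and positive definite forms *)

Section InnerProduct.
Set Implicit Arguments.
Unset Strict Implicit.
Context {K : realType} {r : nat}.
Implicit Types (M N : 'M[K]_r) (x y z : 'cV[K]_r).

Definition dot x y : K := (x^T *m y) 0 0.

Lemma dotE x y : dot x y = \sum_i x i 0 * y i 0.
Proof. by rewrite /dot mxE; apply: eq_bigr => i _; rewrite mxE. Qed.

Lemma dotC x y : dot x y = dot y x.
Proof. by rewrite !dotE; apply: eq_bigr => i _; rewrite mulrC. Qed.

Lemma dotDr x y z : dot x (y + z) = dot x y + dot x z.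
Proof. by rewrite /dot mulmxDr mxE. Qed.

Lemma dotBr x y z : dot x (y - z) = dot x y - dot x z.
Proof. by rewrite /dot mulmxBr !mxE. Qed.

Lemma dotNr x y : dot x (- y) = - dot x y.
Proof. by rewrite /dot mulmxN mxE. Qed.

Lemma dotZr a x y : dot x (a *: y) = a * dot x y.
Proof. by rewrite /dot -scalemxAr mxE. Qed.

Lemma dot0r x : dot x 0 = 0.
Proof. by rewrite /dot mulmx0 mxE. Qed.

Lemma dotBl x y z : dot (x - y) z = dot x z - dot y z.
Proof. by rewrite dotC dotBr !(dotC z). Qed.

Lemma dotZl a x y : dot (a *: x) y = a * dot x y.
Proof. by rewrite dotC dotZr dotC. Qed.

Lemma dot_mulmxl M x y : dot (M *m x) y = dot x (M^T *m y).
Proof. by rewrite /dot trmx_mul mulmxA. Qed.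

Lemma dot_symmx M x y : M^T = M -> dot x (M *m y) = dot y (M *m x).
Proof. by move=> sM; rewrite dotC dot_mulmxl sM. Qed.

Lemma dot_ge0 x : 0 <= dot x x.
Proof. by rewrite dotE; apply: sumr_ge0 => i _; rewrite -expr2 sqr_ge0. Qed.

Lemma sqr_le_dot x i : x i 0 ^+ 2 <= dot x x.
Proof.
rewrite dotE (bigD1 i) //= -expr2 lerDl; apply: sumr_ge0 => j _.
by rewrite -expr2 sqr_ge0.
Qed.

Lemma dot_eq0 x : dot x x = 0 -> x = 0.
Proof.
move=> x0; apply/matrixP => i j; rewrite (ord1 j) mxE.
have := sqr_le_dot x i; rewrite x0 => h.
by apply/eqP; rewrite -sqrf_eq0 eq_le h sqr_ge0.
Qed.

Lemma enormE x : enorm x = Num.sqrt (dot x x).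
Proof. by rewrite /enorm dotE; congr Num.sqrt; apply: eq_bigr => i _; rewrite expr2. Qed.

Lemma psdmxP M :
  psdmx M <-> M^T = M /\ forall x, 0 <= dot x (M *m x).
Proof.
by split=> -[sM Mge0]; split=> // x; have := Mge0 x; rewrite /dot mulmxA.
Qed.

Lemma pdmxP M :
  pdmx M <-> M^T = M /\ forall x, x != 0 -> 0 < dot x (M *m x).
Proof.
split=> -[sM Mgt0]; split=> // x xN0; have := Mgt0 x xN0;
  by rewrite /dot mulmxA.
Qed.

Lemma pdmx_psd M : pdmx M -> psdmx M.
Proof.
move=> /pdmxP[sM Mgt0]; apply/psdmxP; split=> // x.
have [->|xN0] := eqVneq x 0; first by rewrite mulmx0 dot0r.
exact/ltW/Mgt0.
Qed.

(** If [M x] were nonzero, the form would turn negative on moving slightly from [x] along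
    [- M x]. *)
Lemma psdmx_ker M x : psdmx M -> dot x (M *m x) = 0 -> M *m x = 0.
Proof.
move=> /psdmxP[sM Mge0] x0; apply: dot_eq0; set v := M *m x.
set a := dot v v; set b := dot v (M *m v).
have b0 : 0 <= b := Mge0 v.
(* The minimiser would be [a / b]; the added 1 avoids dividing by a zero [b], and the form at
   [x - t v] becomes [- t^2 (b + 2)]. *)
pose t := a / (b + 1).
have tE : t * (b + 1) = a by rewrite /t divfK //; apply/eqP; lra.
have := Mge0 (x - t *: v).
rewrite mulmxBr -scalemxAr dotBr !dotBl !dotZr !dotZl x0.
rewrite (dot_symmx x v sM) -/v -/a -/b => h.
have h2 : 0 <= t * (b * t - 2 * a) by lra.
have h3 : 0 <= - (t ^+ 2 * (b + 2)) by rewrite -tE in h2; lra.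
have h4 : t ^+ 2 = 0.
  by apply/eqP; rewrite eq_le sqr_ge0 andbT; have := sqr_ge0 t; nra.
by move/eqP: h4; rewrite sqrf_eq0 => /eqP t0; rewrite -tE t0 mul0r.
Qed.

Lemma unitmx_inj M : (forall x, M *m x = 0 -> x = 0) -> M \in unitmx.
Proof.
move=> Minj; rewrite -unitmx_tr -row_free_unit; apply: inj_row_free => v v0.
apply/trmx_inj; rewrite trmx0; apply: Minj.
by rewrite -[M]trmxK -trmx_mul v0 trmx0.
Qed.

Lemma pdmx_unit M : pdmx M -> M \in unitmx.
Proof.
move=> /pdmxP[_ Mgt0]; apply: unitmx_inj => x x0; apply/eqP/contraT => xN0.
by have := Mgt0 x xN0; rewrite x0 dot0r ltxx.
Qed.

Lemma invmx_pd M : pdmx M -> pdmx (invmx M).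
Proof.
move=> Mpd; have uM := pdmx_unit Mpd; move: Mpd => /pdmxP[sM Mgt0].
apply/pdmxP; split=> [|x xN0]; first by rewrite trmx_inv sM.
have xE : M *m (invmx M *m x) = x by rewrite mulKVmx.
rewrite -[X in dot X]xE dot_mulmxl sM; apply: Mgt0.
by apply: contra_neq xN0 => x0; rewrite -xE x0 mulmx0.
Qed.

Lemma dot_mulmx_bounded M :
  exists2 c : K, 0 < c & forall x, dot x (M *m x) <= c * dot x x.
Proof.
(* The summand 1 keeps the constant positive even for [M = 0]. *)
exists (1 + \sum_i \sum_j `|M i j|).
  by rewrite ltr_pwDl // sumr_ge0 // => i _; rewrite sumr_ge0.
move=> x; rewrite mulrDl mul1r -[leLHS]add0r lerD ?dot_ge0 //.
rewrite {1}dotE mulr_suml ler_sum // => i _; rewrite mxE mulr_sumr mulr_suml.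
apply: ler_sum => j _.
apply: (le_trans (ler_norm _)); rewrite !normrM mulrCA ler_wpM2l //.
have := sqr_ge0 (`|x i 0| - `|x j 0|).
have := sqr_le_dot x i; have := sqr_le_dot x j.
by rewrite -!(real_normK (num_real (x _ 0))); lra.
Qed.

(* Expand [0 <= (x - t N x)' M (x - t N x)] for [N = M^-1], which is at most
   [x' M x - 2 t x' x + t^2 c x' x], and take [t = 1 / c]. *)
Lemma pdmx_coercive M :
  pdmx M -> exists2 c : K, 0 < c & forall x, c * dot x x <= dot x (M *m x).
Proof.
move=> Mpd; have uM := pdmx_unit Mpd.
have [sM Mge0] := (psdmxP M).1 (pdmx_psd Mpd).
have [c c0 cP] := dot_mulmx_bounded (invmx M).
exists c^-1 => [|x]; first by rewrite invr_gt0.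
have := Mge0 (x - c^-1 *: (invmx M *m x)).
rewrite mulmxBr -scalemxAr mulKVmx // dotBr !dotBl !dotZr !dotZl.
rewrite (dot_symmx (invmx M *m x) x sM) mulKVmx // [dot (_ *m _) x]dotC.
have := cP x; set a := dot x (invmx M *m x); set d := dot x x; set q := dot x (M *m x).
move=> h1 h2.
have h3 : c^-1 * (c^-1 * a) <= c^-1 * d.
  by rewrite ler_pM2l ?invr_gt0 // ler_pdivrMl.
by lra.
Qed.

Lemma pdmx_dominates M N :
  pdmx M -> exists2 e : K, 0 < e < 1 &
    forall x, e * dot x (N *m x) <= dot x (M *m x).
Proof.
move=> /pdmx_coercive[a a0 aP]; have [b b0 bP] := dot_mulmx_bounded N.
have d0 : 0 < a + b by rewrite addr_gt0.
(* With [M >= a] and [N <= b], this value lies below both [a / b] and 1. *)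
exists (a / (a + b)) => [|x].
  by rewrite divr_gt0 //= ltr_pdivrMr // mul1r ltrDl.
rewrite mulrAC ler_pdivrMr //; apply: (@le_trans _ _ (a * b * dot x x)).
  by rewrite -mulrA ler_pM2l.
have := aP x; have := dot_ge0 x => h1 h2.
have := mulr_ge0 (ltW a0) (mulr_ge0 (ltW a0) h1).
by nra.
Qed.

End InnerProduct.

(** * Algebra of the Riccati map and of the Gramians *)

Section Riccati.
Set Implicit Arguments.
Unset Strict Implicit.
Context {K : realType} {r : nat}.
Implicit Types (A B M N P Q R S : 'M[K]_r) (x y z : 'cV[K]_r).

Lemma psdmxD M N : psdmx M -> psdmx N -> psdmx (M + N).
Proof.
move=> /psdmxP[sM M0] /psdmxP[sN N0]; apply/psdmxP.
by split=> [|x]; rewrite ?linearD /= ?sM ?sN // mulmxDl dotDr addr_ge0.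
Qed.

Lemma psdmx_congr B M : psdmx M -> psdmx (B *m M *m B^T).
Proof.
move=> /psdmxP[sM M0]; apply/psdmxP; split=> [|x].
  by rewrite !trmx_mul trmxK sM mulmxA.
by rewrite -!mulmxA -{1}[B]trmxK -dot_mulmxl.
Qed.

Lemma tr_1DPS P S : P^T = P -> S^T = S -> (1%:M + P *m S)^T = 1%:M + S *m P.
Proof. by move=> sP sS; rewrite linearD /= trmx1 trmx_mul sP sS. Qed.

(** If [x = - P S x], the form of [P] at [S x] equals [- x' S x], so it vanishes and [psdmx_ker]
    gives [P S x = 0]. *)
Lemma unitmx_1DPS P S : psdmx P -> psdmx S -> 1%:M + P *m S \in unitmx.
Proof.
move=> Ppsd /psdmxP[_ S0]; apply: unitmx_inj => x.
rewrite mulmxDl mul1mx -mulmxA => /eqP; rewrite addr_eq0 => /eqP xE.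
suff PSx0 : P *m (S *m x) = 0 by rewrite xE PSx0 oppr0.
apply: psdmx_ker => //; apply/eqP; rewrite eq_le ((psdmxP P).1 Ppsd).2 andbT.
by rewrite -oppr_ge0 -dotNr -xE dotC.
Qed.

(** Push-through identity, from [(1 + P S) P = P (1 + S P)]. *)
Lemma invmx_1DPS_comm P S : psdmx P -> psdmx S ->
  invmx (1%:M + P *m S) *m P = P *m invmx (1%:M + S *m P).
Proof.
move=> Pp Sp; have uT := unitmx_1DPS Pp Sp; have uT' := unitmx_1DPS Sp Pp.
apply: (canLR (mulKmx uT)); rewrite mulmxA; apply: (canRL (mulmxK uT')).
by rewrite mulmxDr mulmxDl mulmx1 mul1mx !mulmxA.
Qed.

Lemma riccati_psd A R S P :
  psdmx R -> psdmx S -> psdmx P -> psdmx (riccati A R S P).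
Proof.
move=> Rp Sp Pp; apply: psdmxD => //.
have [sP _] := Pp; have [sS _] := Sp; have uT' := unitmx_1DPS Sp Pp.
rewrite -[A *m _ *m P]mulmxA; apply: psdmx_congr.
(* Rewriting as a congruence of [P + P S P'] makes symmetry and positivity visible. *)
have -> : invmx (1%:M + P *m S) *m P = invmx (1%:M + P *m S) *m
    (P + P *m S *m P^T) *m (invmx (1%:M + P *m S))^T.
  rewrite trmx_inv tr_1DPS // sP -[RHS]mulmxA; congr (_ *m _).
  by apply: (canRL (mulmxK uT')); rewrite mulmxDr mulmx1 mulmxA.
by apply: psdmx_congr; apply: psdmxD => //; apply: psdmx_congr.
Qed.

(** Once [Q] is pushed through, clearing both inverses leaves
    [P (1 + S Q) - (1 + P S) Q = P - Q]. *)
Lemma riccati_sub A R S P Q : psdmx S -> psdmx P -> psdmx Q ->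
  riccati A R S P - riccati A R S Q
  = trans A S P *m (P - Q) *m (trans A S Q)^T.
Proof.
move=> Sp Pp Qp; have [sQ _] := Qp; have [sS _] := Sp.
have uT := unitmx_1DPS Pp Sp; have uT' := unitmx_1DPS Sp Qp.
rewrite /riccati /trans opprD addrACA subrr addr0 trmx_mul trmx_inv tr_1DPS //.
rewrite -!(mulmxA A) -mulmxBr -mulmxBl (invmx_1DPS_comm Qp Sp) !mulmxA.
congr (_ *m A^T); rewrite -!mulmxA; congr (A *m _); rewrite mulmxA.
apply: (canRL (mulmxK uT')); rewrite mulmxBl mulmxKV //.
apply: (canRL (mulKmx uT)); rewrite mulmxBr -mulmxA mulKVmx //.
by rewrite mulmxDr mulmx1 mulmxDl mul1mx mulmxA opprD addrACA subrr addr0.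
Qed.

(** With [E] and [F] taken at [Q], the terms in [E' G_n E] agree by [riccati_sub]; the rest is
    [1 + (P - Q) F = (1 + P S) (1 + Q S)^-1]. *)
Lemma trans_Lmx A R S Q n P : psdmx S -> psdmx Q -> riccati A R S Q = Q ->
  psdmx P ->
  trans A S P *m Lmx A S Q n.+1 P
  = Lmx A S Q n (riccati A R S P) *m trans A S Q.
Proof.
move=> Sp Qp Qfix Pp; have uTQ := unitmx_1DPS Qp Sp.
have uTP := unitmx_1DPS Pp Sp.
rewrite /Lmx -{3}Qfix riccati_sub //=.
rewrite [RHS]mulmxDl mul1mx [(P - Q) *m _]mulmxDr [(P - Q) *m _ + _]addrC addrA.
rewrite [LHS]mulmxDr !mulmxA; congr (_ + _).
rewrite mulmxDr mulmx1 -!mulmxA.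
rewrite /trans -mulmxDr; congr (A *m _).
rewrite -[X in X + _]mulmx1 -mulmxDr; apply: (canLR (mulKmx uTP)).
apply: (canRL (mulmxK uTQ)); rewrite mulmxDl mul1mx mulmxA mulmxKV //.
by rewrite mulmxBl -addrA [Q *m S + _]addrC subrK.
Qed.

Lemma transn_Lmx A R S Q n P : psdmx R -> psdmx S -> psdmx Q ->
  riccati A R S Q = Q -> psdmx P ->
  transn A R S n P *m Lmx A S Q n P = trans A S Q ^+ n.
Proof.
move=> Rp Sp Qp Qfix; elim: n P => [|n IHn] P Pp.
  by rewrite /Lmx /= mulmx0 addr0 mulmx1.
rewrite [transn _ _ _ _ _]/= -mulmxA (trans_Lmx _ Sp Qp Qfix Pp) mulmxA.
by rewrite IHn ?exprSr //; exact: riccati_psd.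
Qed.

Lemma dot_gramian A S Q n x :
  dot x (gramian A S Q n *m x) =
  \sum_(k < n) dot (trans A S Q ^+ k *m x)
    (S *m invmx (1%:M + Q *m S) *m (trans A S Q ^+ k *m x)).
Proof.
elim: n x => [|n IHn] x; first by rewrite big_ord0 mul0mx dot0r.
rewrite big_ord_recl /= mul1mx mulmxDl dotDr addrC; congr (_ + _).
rewrite -[X in dot x X]mulmxA -[X in dot x X]mulmxA -dot_mulmxl IHn.
by apply: eq_bigr => k _; rewrite exprSr mulmxA.
Qed.

Lemma gramian_tr A S Q n : psdmx S -> psdmx Q ->
  (gramian A S Q n)^T = gramian A S Q n.
Proof.
move=> Sp Qp; have [sS _] := Sp; have [sQ _] := Qp.
elim: n => [|n IHn] /=; first by rewrite trmx0.
rewrite linearD /= [(S *m _)^T]trmx_mul trmx_inv tr_1DPS // sS.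
rewrite invmx_1DPS_comm //; congr (_ + _).
by rewrite trmx_mul [(_^T *m _)^T]trmx_mul trmxK IHn mulmxA.
Qed.

End Riccati.

(** * Kernel forms of the rank conditions, and the perturbation estimate *)

Section Kalman.
Set Implicit Arguments.
Unset Strict Implicit.
Context {K : realType} {r : nat}.
Implicit Types (A B C G P Q R S : 'M[K]_r) (x y p : 'cV[K]_r).

Lemma trmx_exp A k : (A ^+ k)^T = A^T ^+ k.
Proof.
elim: k => [|k IHk]; first by rewrite !expr0 trmx1.
by rewrite exprS exprSr trmx_mul IHk.
Qed.

(** Transposed, the hypotheses say that [p'] annihilates each block of a matrix of full row rank. *)
Lemma controllable_ker A B p : controllable A B ->
  (forall k, (k < r)%N -> B^T *m (A^T ^+ k *m p) = 0) -> p = 0.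
Proof.
move=> AB Bp; apply/trmx_inj/(@row_free_inj _ _ _ _ (\mxrow_(k < r) (A ^+ k *m B))).
  by rewrite /row_free AB.
rewrite /= trmx0 mul0mx mul_mxrow -[RHS]mxrow0; apply: eq_mxrow => k.
by apply: trmx_inj; rewrite !trmx_mul trmxK trmx_exp trmx0 -mulmxA Bp.
Qed.

(** Dual of [controllable_ker], applied to [A'] and [C']. *)
Lemma observable_ker A C x : observable A C ->
  (forall k, (k < r)%N -> C *m (A ^+ k *m x) = 0) -> x = 0.
Proof.
move=> AC Cx; apply: (@controllable_ker A^T C^T) => [|k kr]; last first.
  by rewrite !trmxK Cx.
rewrite /controllable -mxrank_tr tr_mxrow -[RHS]AC; congr (\rank _).
by apply: eq_mxcol => k; rewrite trmx_mul trmx_exp !trmxK.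
Qed.

Lemma sym_sqrtmx_ker R B x : sym_sqrtmx R B -> dot x (R *m x) = 0 -> B *m x = 0.
Proof.
move=> [sB <-]; rewrite -mulmxA -{1}sB -dot_mulmxl; exact: dot_eq0.
Qed.

(* With [g = G x] and [w = L x], the upper bound on [G] yields
   [g' Q g <= (1 - e) x' G x], so that [g' w >= e x' G x]; the bound on [w]
   follows by Young's inequality, as [m g' g <= g' Q g]. *)
Lemma perturbation_bound G P Q (c e m : K) :
  G^T = G -> psdmx P -> Q^T = Q -> Q \in unitmx ->
  0 < c -> 0 < e < 1 -> 0 < m ->
  (forall x, c * dot x x <= dot x (G *m x)) ->
  (forall x, dot x (G *m x) <= (1 - e) * dot x (invmx Q *m x)) ->
  (forall x, m * dot x x <= dot x (Q *m x)) ->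
  let L := 1%:M + (P - Q) *m G in
  forall x, e ^+ 2 * m * c * dot x x <= dot (L *m x) (L *m x).
Proof.
move=> sG /psdmxP[_ P0] sQ uQ c0 /andP[e0 e1] m0 cG GQ mQ /= x.
set w := _ *m x; pose g := G *m x; pose y := Q *m g.
have wE : w = x + P *m g - Q *m g.
  by rewrite /w mulmxDl mul1mx -mulmxA mulmxBl addrA.
pose a := dot x g; pose q := dot g y; pose k := 1 - e.
have k0 : 0 < k by rewrite subr_gt0.
have qa : q <= k * a.
  have Gy : dot y (G *m y) <= k * q.
    by apply: le_trans (GQ y) _; rewrite mulKmx // dotC.
  (* This form is [k^2 a - 2 k q + y' G y], hence at most [k^2 a - k q]. *)
  have G0 : 0 <= dot (k *: x - y) (G *m (k *: x - y)).
    by apply: le_trans (cG _); rewrite mulr_ge0 ?dot_ge0 // ltW.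
  move: G0; rewrite mulmxBr -scalemxAr dotBr !dotBl !dotZr !dotZl.
  rewrite (dot_symmx x y sG) -/g -/a [dot y g]dotC -/q => G0.
  by rewrite -(ler_pM2l k0); lra.
have mq : m * dot g g <= a.
  have a0 : 0 <= a by apply: le_trans (cG x); rewrite mulr_ge0 ?dot_ge0 // ltW.
  by apply: le_trans (mQ g) _; apply: le_trans qa _; rewrite /k; nra.
have gw : e * a <= dot g w.
  by rewrite wE dotBr dotDr [dot g x]dotC; have := P0 g; rewrite -/a -/y -/q /k in qa *; lra.
(* With the weight [e m], the loss [e^2 m^2 g' g] is at most [e^2 m a], half of the gain
   [2 e m g' w >= 2 e^2 m a]. *)
have := dot_ge0 (e * m *: g - w).
rewrite dotBr !dotBl !dotZr !dotZl [dot w g]dotC => h.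
have h1 : (e * m * e) * (m * dot g g) <= (e * m * e) * a.
  by rewrite ler_pM2l // !mulr_gt0.
have h2 : e * m * (e * a) <= e * m * dot g w by rewrite ler_pM2l // mulr_gt0.
have h3 : e * m * e * (c * dot x x) <= e * m * e * a.
  by rewrite ler_pM2l ?mulr_gt0 // cG.
by lra.
Qed.

End Kalman.

(** * Definiteness of the Gramian and of its gap to [V] *)

Section SteadyState.
Context {K : realType} {r : nat} {A R S Rh Sh Pinf : 'M[K]_r}.
Hypotheses (R_psd : psdmx R) (S_psd : psdmx S).
Hypotheses (Rh_sqrt : sym_sqrtmx R Rh) (Sh_sqrt : sym_sqrtmx S Sh).
Hypotheses (ctrl : controllable A Rh) (obs : observable A Sh).
Hypotheses (Pinf_pd : pdmx Pinf) (Pinf_fix : riccati A R S Pinf = Pinf).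

Let sP : Pinf^T = Pinf. Proof. by case: Pinf_pd. Qed.
Let sS : S^T = S. Proof. by case: S_psd. Qed.
Let P_psd : psdmx Pinf := pdmx_psd Pinf_pd.
Let uP : Pinf \in unitmx := pdmx_unit Pinf_pd.
Let T := 1%:M + Pinf *m S.
Let T' := 1%:M + S *m Pinf.
Let uT : T \in unitmx := unitmx_1DPS P_psd S_psd.
Let uT' : T' \in unitmx := unitmx_1DPS S_psd P_psd.
Let V := invmx Pinf.
Let E := trans A S Pinf.
Let F := S *m invmx T.
Let W := T *m Pinf.

Let E_tr : E^T = invmx T' *m A^T.
Proof. by rewrite trmx_mul trmx_inv tr_1DPS. Qed.

Let W_pd : pdmx W.
Proof.
have WE : W = Pinf + Pinf *m S *m Pinf^T by rewrite /W /T mulmxDl mul1mx sP.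
apply/pdmxP; split=> [|x xN0].
  by rewrite WE linearD /= 2!trmx_mul trmxK sP sS mulmxA.
rewrite WE mulmxDl dotDr ltr_wpDr //; last exact: ((pdmxP _).1 Pinf_pd).2.
by have /psdmxP[_] := psdmx_congr Pinf S_psd; apply.
Qed.

(** Since [V T = V + S] and [F T = S], one has [(V - F) T = V]. *)
Let invmxW : invmx W = V - F.
Proof.
have VFW : (V - F) *m W = 1%:M.
  rewrite /W mulmxA mulmxBl mulmxKV // /T mulmxDr mulmx1 mulmxA mulVmx //.
  by rewrite mul1mx addrK mulVmx.
by rewrite -[RHS](mulmxK (pdmx_unit W_pd)) VFW mul1mx.
Qed.

(** Lyapunov form of the fixed-point equation: [E W E'] collapses to [A Pinf T'^-1 A^T], and
    push-through does the rest. *)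
Let Pinf_decomp : Pinf = E *m W *m E^T + R.
Proof.
rewrite -{1}Pinf_fix E_tr /riccati /E /trans /W; congr (_ + _).
rewrite mulmxA -(mulmxA A) -!(mulmxA A) invmx_1DPS_comm // !mulmxA.
by rewrite mulmxKV.
Qed.

(** The quadratic form of [U = V - F - E' V E]. *)
Let decrement x := dot x (V *m x) - dot x (F *m x) - dot (E *m x) (V *m (E *m x)).

(* Complete the square in the [W^-1] form, using [Pinf = E W E' + R]. *)
Let decrementE x (p := V *m (E *m x)) (z := x - W *m (E^T *m p)) :
  decrement x = dot z (invmx W *m z) + dot p (R *m p).
Proof.
have [sW _] := W_pd; have uW := pdmx_unit W_pd.
have Ex : E *m x = Pinf *m p by rewrite mulKVmx.
have Rp : R *m p = E *m x - E *m (W *m (E^T *m p)).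
  by rewrite Ex {1}Pinf_decomp mulmxDl -!mulmxA addrAC subrr add0r.
rewrite Rp /decrement -/p /z mulmxBr mulKmx // !dotBr !dotBl.
rewrite -dotBr -mulmxBl -invmxW.
rewrite [dot (W *m _) (invmx W *m x)]dot_mulmxl sW mulKVmx //.
rewrite [dot (E^T *m p) x]dotC -!dot_mulmxl !(dotC p).
by lra.
Qed.

Let decrement_ge0 x : 0 <= decrement x.
Proof.
rewrite decrementE addr_ge0 //; last exact: ((psdmxP _).1 R_psd).2.
by case/psdmxP: (pdmx_psd (invmx_pd W_pd)).
Qed.

(** Both summands of [decrementE] vanish. The first gives [x = W E^T p], where
    [W E^T = Pinf T' T'^-1 A^T = Pinf A^T]. *)
Let decrement_eq0 x : decrement x = 0 ->
  Rh *m (V *m (E *m x)) = 0 /\ V *m x = A^T *m (V *m (E *m x)).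
Proof.
rewrite decrementE; set p := V *m (E *m x); set z := x - _ => /eqP.
have [_ R0] := (psdmxP _).1 R_psd.
have Wipd := invmx_pd W_pd; have [_ Wi0] := (psdmxP _).1 (pdmx_psd Wipd).
rewrite paddr_eq0 // => /andP[/eqP z0 /eqP Rp]; split.
  exact: sym_sqrtmx_ker Rh_sqrt Rp.
have {}z0 : z = 0.
  apply/eqP/contraT => zN0; have := ((pdmxP _).1 Wipd).2 z zN0.
  by rewrite z0 ltxx.
have -> : x = W *m (E^T *m p) by apply/eqP; rewrite -subr_eq0 -/z z0.
have -> : W = Pinf *m T' by rewrite /W /T /T' mulmxDl mulmxDr mul1mx mulmx1 mulmxA.
by rewrite E_tr !mulmxA mulVmx // mul1mx mulmxV // mul1mx.
Qed.

(** The [V] terms telescope and the [F] terms add up to the Gramian. *)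
Let sum_decrement n x :
  \sum_(k < n) decrement (E ^+ k *m x)
  = dot x (V *m x) - dot x (gramian A S Pinf n *m x)
    - dot (E ^+ n *m x) (V *m (E ^+ n *m x)).
Proof.
elim: n => [|n IHn]; first by rewrite big_ord0 mul0mx dot0r mul1mx subr0 subrr.
rewrite big_ord_recr IHn !dot_gramian big_ord_recr /= /decrement -/E -/T -/F.
by rewrite exprS -[E * _ *m x]mulmxA; lra.
Qed.

(** The part of [V - G_n] common to all [n >= r], so that bounds drawn from it are uniform in
    [n]. *)
Let margin := V - gramian A S Pinf r - (E ^+ r)^T *m V *m E ^+ r.

Let marginE x : dot x (margin *m x) = \sum_(k < r) decrement (E ^+ k *m x).
Proof.
rewrite sum_decrement /margin !mulmxBl !dotBr; congr (_ - _).
by rewrite dot_mulmxl !mulmxA.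
Qed.

(* On the kernel of [margin], [p k = V E^k x] satisfies [p k = A' p (k+1)] and
   [R p (k+1) = 0] for [k < r], so controllability forces [p r = 0]. *)
Let margin_pd : pdmx margin.
Proof.
have [sV _] := invmx_pd Pinf_pd.
apply/pdmxP; split=> [|x].
  by rewrite /margin !linearB /= gramian_tr // 2!trmx_mul trmxK sV mulmxA.
rewrite marginE => xN0; rewrite lt_def sumr_ge0 // andbT.
apply: contra_neq xN0 => sum0.
have dec0 k : (k < r)%N -> decrement (E ^+ k *m x) = 0.
  move=> kr; move/eqP: sum0; rewrite psumr_eq0 // => /allP/(_ (Ordinal kr)).
  by rewrite mem_index_enum => /(_ isT)/eqP.
pose p k := V *m (E ^+ k *m x).
have pS k : (k < r)%N -> Rh *m p k.+1 = 0 /\ p k = A^T *m p k.+1.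
  by move=> /dec0/decrement_eq0; rewrite /p exprS -[E * _ *m x]mulmxA.
have pr j : (j <= r)%N -> p (r - j)%N = A^T ^+ j *m p r.
  elim: j => [|j IHj] jr; first by rewrite subn0 mul1mx.
  have kr : (r - j.+1 < r)%N by rewrite ltn_subrL (leq_trans _ jr).
  by rewrite (pS _ kr).2 subnSK // IHj ?(ltnW jr) // exprS -[RHS]mulmxA.
have pr0 : p r = 0.
  apply: (controllable_ker ctrl) => j jr; have [-> _] := Rh_sqrt.
  (* For [j < r] the index [r - j] is a successor, as [pS] requires for [Rh p = 0]. *)
  rewrite -pr ?(ltnW jr) // -[(r - j)%N]prednK ?subn_gt0 //.
  by apply: (pS _ _).1; rewrite prednK ?subn_gt0 // leq_subr.
have := pr r (leqnn r); rewrite subnn pr0 mulmx0 /p mul1mx => Vx0.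
by rewrite -[x](mulKVmx uP) -/V Vx0 mulmx0.
Qed.

(** Same symmetrisation as in [riccati_psd], now a congruence of [S + S Pinf S']. *)
Let F_psd : psdmx F.
Proof.
have -> : F = invmx T' *m (S + S *m Pinf *m S^T) *m (invmx T')^T.
  rewrite trmx_inv tr_1DPS // sS; congr (_ *m _).
  by apply: (canRL (mulKmx uT')); rewrite mulmxDl mul1mx.
by apply: psdmx_congr; apply: psdmxD => //; apply: psdmx_congr.
Qed.

Let F_eq0 y : dot y (F *m y) = 0 -> S *m y = 0.
Proof.
move=> /(psdmx_ker F_psd).
rewrite /F -(invmx_1DPS_comm S_psd P_psd) -mulmxA => Fy.
by rewrite -[S *m y](mulKVmx uT') Fy mulmx0.
Qed.

Let gramian_mono n x : (r <= n)%N ->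
  dot x (gramian A S Pinf r *m x) <= dot x (gramian A S Pinf n *m x).
Proof.
move=> rn; have [_ F0] := (psdmxP _).1 F_psd.
rewrite !dot_gramian -(subnK rn) addnC big_split_ord /= lerDl.
by apply: sumr_ge0.
Qed.

(* On the kernel of [F], [E] coincides with [A]. *)
Let gramian_pd : pdmx (gramian A S Pinf r).
Proof.
have [_ F0] := (psdmxP _).1 F_psd.
apply/pdmxP; split=> [|x]; first exact: gramian_tr.
rewrite dot_gramian => xN0; rewrite lt_def sumr_ge0 // andbT.
apply: contra_neq xN0 => sum0.
have SE k : (k < r)%N -> S *m (E ^+ k *m x) = 0.
  move=> kr; apply: F_eq0; move/eqP: sum0; rewrite psumr_eq0 // => /allP.
  by move=> /(_ (Ordinal kr)); rewrite mem_index_enum => /(_ isT)/eqP.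
have EA k : (k <= r)%N -> E ^+ k *m x = A ^+ k *m x.
  elim: k => [//|k IHk] kr; rewrite !exprS -[LHS]mulmxA -[RHS]mulmxA.
  rewrite -IHk ?(ltnW kr) //; set y := E ^+ k *m x.
  have Ty : T *m y = y by rewrite mulmxDl mul1mx -mulmxA SE // mulmx0 addr0.
  by rewrite -[in LHS]Ty /E /trans -/T -mulmxA mulKmx.
apply: (observable_ker obs) => k kr; apply: (sym_sqrtmx_ker Sh_sqrt).
by rewrite -EA ?(ltnW kr) // SE // dot0r.
Qed.

(** Only the first [r] decrements are kept; the later ones and the final [V] term are
    nonnegative. *)
Let gramian_le n x : (r <= n)%N ->
  dot x (margin *m x)
  <= dot x (V *m x) - dot x (gramian A S Pinf n *m x).
Proof.
move=> rn; rewrite marginE.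
apply: (@le_trans _ _ (\sum_(k < n) decrement (E ^+ k *m x))).
  by rewrite -(subnK rn) addnC big_split_ord /= lerDl sumr_ge0.
rewrite sum_decrement lerBlDr lerDl.
by have [_] := (psdmxP _).1 (pdmx_psd (invmx_pd Pinf_pd)); apply.
Qed.

Lemma Lmx_coercive : exists2 k : K, 0 < k & forall n P x,
  (r <= n)%N -> psdmx P ->
  k * dot x x <= dot (Lmx A S Pinf n P *m x) (Lmx A S Pinf n P *m x).
Proof.
have [c c0 cP] := pdmx_coercive gramian_pd.
have [m m0 mP] := pdmx_coercive Pinf_pd.
(* As [margin >= e V], [gramian_le] becomes [G_n <= (1 - e) V]. All three constants are fixed before
   [n] and [P]. *)
have [e e01 eP] := pdmx_dominates V margin_pd.
exists (e ^+ 2 * m * c) => [|n P x rn Pp].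
  by case/andP: e01 => e0 _; rewrite !mulr_gt0 ?exprn_gt0.
apply: perturbation_bound => // [|y|y]; first exact: gramian_tr.
  exact: le_trans (cP y) (gramian_mono y rn).
by have := eP y; have := gramian_le y rn; rewrite -/V; lra.
Qed.

End SteadyState.

(** * From the lower bound to the spectral norm and the theorem *)

Lemma specnorm_invmx_le (K : realType) (r : nat) (M : 'M[K]_r) (k : K) :
  M \in unitmx -> 0 < k ->
  (forall x : 'cV[K]_r, k * dot x x <= dot (M *m x) (M *m x)) ->
  specnorm (invmx M) <= Num.sqrt k^-1.
Proof.
move=> uM k0 kM; apply: ge_sup => [|_ /= [x x1 <-]].
  (* The supremum bound requires a nonempty set, witnessed by the zero vector. *)
  by exists (enorm (invmx M *m 0)); exists 0; rewrite //= enormE dot0r sqrtr0.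
rewrite enormE ler_sqrt ?invr_ge0 ?(ltW k0) // -[k^-1]mulr1 ler_pdivlMl //.
apply: le_trans (kM _) _; rewrite mulKVmx //.
by move: x1; rewrite enormE -[in X in _ <= X](@sqrtr1 K) ler_sqrt.
Qed.

Theorem theorem1p3 (K : realType) (r : nat) (r_ge1 : (1 <= r)%N)
    (A R S Rh Sh Pinf : 'M[K]_r)
    (R_psd : psdmx R) (S_psd : psdmx S)
    (Rh_sqrt : sym_sqrtmx R Rh) (Sh_sqrt : sym_sqrtmx S Sh)
    (ctrl : controllable A Rh) (obs : observable A Sh)
    (Pinf_pd : pdmx Pinf) (Pinf_fix : riccati A R S Pinf = Pinf) :
  [/\ (forall (n : nat) (P : 'M[K]_r), (r <= n)%N -> psdmx P ->
         Lmx A S Pinf n P \in unitmx),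
      (forall (n : nat) (P : 'M[K]_r), (r <= n)%N -> psdmx P ->
         transn A R S n P = trans A S Pinf ^+ n *m invmx (Lmx A S Pinf n P))
    & (ereal_sup [set ereal_sup [set (specnorm (invmx (Lmx A S Pinf n P)))%:E
                                | n in [set n | (r <= n)%N]]
                 | P in [set P | psdmx P]] < +oo)%E].
Proof.
have [k k0 kL] :=
  Lmx_coercive R_psd S_psd Rh_sqrt Sh_sqrt ctrl obs Pinf_pd Pinf_fix.
have uL n P : (r <= n)%N -> psdmx P -> Lmx A S Pinf n P \in unitmx.
  move=> rn Pp; apply: unitmx_inj => x Lx0; apply: dot_eq0.
  apply/eqP; rewrite eq_le dot_ge0 andbT -(pmulr_rle0 _ k0).
  by have := kL n P x rn Pp; rewrite Lx0 dot0r.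
split=> // [n P rn Pp|].
  rewrite -(transn_Lmx n R_psd S_psd (pdmx_psd Pinf_pd) Pinf_fix Pp).
  by rewrite mulmxK // uL.
apply: (@le_lt_trans _ _ (Num.sqrt k^-1)%:E); last exact: ltry.
apply: ge_ereal_sup => _ /= [P Pp <-]; apply: ge_ereal_sup => _ /= [n rn <-].
by rewrite lee_fin; apply: specnorm_invmx_le => // [|x]; [exact: uL|exact: kL].
Qed.
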